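(* Let $(A,[\cdot,\cdot],\alpha)$ be a Hom-Lie algebra and let $P:A\to A$ be an idempotent linear operator, i.e. a linear map with $P^2=P$ and $\alpha\circ P=P\circ\alpha$. Let $A=A_0\oplus A_1$ be the corresponding linear decomposition, where $A_0=\mathrm{im}(P)$ and $A_1=\ker(P)$. Then $P$ is an averaging operator if and only if $$[A_0,A_0]\subseteq A_0,\qquad [A_0,A_1]\subseteq A_1.$$
   Context: All vector spaces are over a field $\mathbb{K}$ of characteristic zero. A Hom-Lie algebra $(A,[\cdot,\cdot],\alpha)$ is a vector space $A$ with a bilinear product $[\cdot,\cdot]$ and a linear map $\alpha:A\to A$ such that $[x,y]=-[y,x]$ and $[\alpha(x),[y,z]]+[\alpha(y),[z,x]]+[\alpha(z),[x,y]]=0$ for all $x,y,z\in A$. An averaging operator on it is a linear map $P:A\to A$ with $\alpha\circ P=P\circ\alpha$ and $[P(x),P(y)]=P([P(x),y])=P([x,P(y)])$ for all $x,y\in A$. *)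

(* Defs.v *)
From mathcomp Require Import all_boot all_order all_algebra.
From mathcomp Require Import boolp classical_sets.

Set Implicit Arguments.
Unset Strict Implicit.
Unset Printing Implicit Defensive.

Import GRing.Theory.
Local Open Scope classical_set_scope.
Local Open Scope ring_scope.

(* The Hom-Lie structure lives on an arbitrary vector space, possibly
   infinite-dimensional; the twisting map alpha is not required to be
   multiplicative for the bracket. *)
Record homLie (K : fieldType) (A : lmodType K) := HomLie {
  bracket : {bilinear A -> A -> A};
  twist : {linear A -> A};
  bracket_anti : forall x y, bracket x y = - bracket y x;
  hom_jacobi : forall x y z,
    bracket (twist x) (bracket y z) + bracket (twist y) (bracket z x)
    + bracket (twist z) (bracket x y) = 0 }.

Section HomLieTheory.
Variables (K : fieldType) (A : lmodType K) (L : homLie A).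

Definition averaging_operator (P : {linear A -> A}) : Prop :=
  twist L \o P =1 P \o twist L /\
  forall x y,
    bracket L (P x) (P y) = P (bracket L (P x) y) /\
    bracket L (P x) (P y) = P (bracket L x (P y)).

Definition idempotent_operator (P : {linear A -> A}) : Prop :=
  P \o P =1 P /\ twist L \o P =1 P \o twist L.

(* The usual convention for [U, V]: a span, not only the set of brackets. *)
Definition bracket_span (U V : set A) : set A :=
  [set z | exists (n : nat) (c : 'I_n -> K) (u v : 'I_n -> A),
    [/\ forall i, U (u i), forall i, V (v i) &
        z = \sum_(i < n) c i *: bracket L (u i) (v i)]].

End HomLieTheory.

Definition im (K : fieldType) (A : lmodType K) (P : {linear A -> A}) : set A :=
  range P.

Definition ker (K : fieldType) (A : lmodType K) (P : {linear A -> A}) : set A :=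
  P @^-1` [set 0].

(* A = im P (+) ker P, as unique existence of components, since the two
   subspaces are plain sets. *)
Lemma idempotent_decomposition (K : fieldType) (A : lmodType K)
    (P : {linear A -> A}) :
  P \o P =1 P ->
  forall x, exists! p : A * A, [/\ im P p.1, ker P p.2 & x = p.1 + p.2].
Proof.
move=> PP x; exists (P x, x - P x); split.
  split=> /=; [by exists x | | by rewrite addrC subrK].
  by rewrite /ker /= linearB /= [P (P x)]PP subrr.
case=> _ b [/= [a _ <-] Pb ->]; rewrite /ker /= in Pb.
by rewrite linearD /= [P (P a)]PP Pb addr0 addrC addKr.
Qed.

(* Main.v *)
Require Import Defs.
From mathcomp Require Import all_boot all_order all_algebra.
From mathcomp Require Import boolp classical_sets.

Import GRing.Theory.
Local Open Scope classical_set_scope.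
Local Open Scope ring_scope.

(** Since [im P] and [ker P] are linear subspaces, each of the two inclusions
    between spans only has to be checked on single brackets
    ([bracket_span_subset]).  If [P] is averaging, then [P x, P y] is a value of
    [P], and for [v] in the kernel [P] sends [P x, v] to [P x, P v] = 0.
    Conversely, split [y] as [P y + (y - P y)]: the bracket [P x, P y] lies in
    the image and is therefore fixed by the projection, while [P x, y - P y]
    lies in the kernel, so [P] sends [P x, y] to [P x, P y].  The averaging
    identity in the other argument follows by antisymmetry
    ([left_averaging_right]). *)

Lemma bracket_span_subset (K : fieldType) (A : lmodType K) (L : homLie A)
    (U V W : set A) :
  W 0 -> (forall x y, W x -> W y -> W (x + y)) ->
  (forall (c : K) x, W x -> W (c *: x)) ->
  bracket_span L U V `<=` W <->
    forall u v, U u -> V v -> W (bracket L u v).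
Proof.
move=> W0 WD WZ; split=> [sub u v Uu Vv | Wuv z [n [c [u [v [Uu Vv ->]]]]]].
  apply: sub; exists 1, (fun=> 1), (fun=> u), (fun=> v); split=> //.
  by rewrite big_ord1 scale1r.
by apply: (big_ind W) => // i _; apply/WZ/Wuv.
Qed.

Lemma im_bracket_span_subset (K : fieldType) (A : lmodType K) (L : homLie A)
    (U V : set A) (P : {linear A -> A}) :
  bracket_span L U V `<=` im P <->
    forall u v, U u -> V v -> im P (bracket L u v).
Proof.
apply: bracket_span_subset; first by exists 0; rewrite ?linear0.
  by move=> _ _ [x _ <-] [y _ <-]; exists (x + y); rewrite ?linearD.
by move=> c _ [x _ <-]; exists (c *: x); rewrite ?linearZ.
Qed.

Lemma ker_bracket_span_subset (K : fieldType) (A : lmodType K) (L : homLie A)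
    (U V : set A) (P : {linear A -> A}) :
  bracket_span L U V `<=` ker P <->
    forall u v, U u -> V v -> P (bracket L u v) = 0.
Proof.
apply: (@bracket_span_subset K A L U V (ker P)); rewrite /ker /=.
- exact: linear0.
- by move=> x y Px Py; rewrite linearD Px Py addr0.
- by move=> c x Px; rewrite linearZ /= Px scaler0.
Qed.

(** Antisymmetry exchanges the two averaging identities at the cost of a sign
    that cancels, because [P] is additive. *)
Lemma left_averaging_right (K : fieldType) (A : lmodType K) (L : homLie A)
    (P : {linear A -> A}) :
  (forall x y, bracket L (P x) (P y) = P (bracket L (P x) y)) ->
  forall x y, bracket L (P x) (P y) = P (bracket L x (P y)).
Proof.
by move=> avg x y; rewrite bracket_anti avg -linearN -bracket_anti.
Qed.

Theorem proposition2p24 (K : fieldType) (char0 : [pchar K] =i pred0)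
    (A : lmodType K) (L : homLie A) (P : {linear A -> A}) :
  idempotent_operator L P ->
  let A0 := im P in
  let A1 := ker P in
  averaging_operator L P <->
    bracket_span L A0 A0 `<=` A0 /\ bracket_span L A0 A1 `<=` A1.
Proof.
move=> [PP twistP] A0 A1.
rewrite im_bracket_span_subset ker_bracket_span_subset.
split=> [[_ avg] | [im00 ker01]].
  split=> [_ _ [x _ <-] [y _ <-] | _ v [x _ <-] Pv].
    by exists (bracket L (P x) y); rewrite ?(avg x y).1.
  by rewrite -(avg x v).1 [P v]Pv linear0r.
have avgl x y : bracket L (P x) (P y) = P (bracket L (P x) y).
  have Pfix : P (bracket L (P x) (P y)) = bracket L (P x) (P y).
    have [||a _ <-] := im00 (P x) (P y); [by exists x | by exists y |].
    exact: PP.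
  have Pkill : P (bracket L (P x) (y - P y)) = 0.
    apply: ker01; first by exists x.
    by rewrite /A1 /ker /= linearB /= [P (P y)]PP subrr.
  by rewrite -[in RHS](subrK (P y) y) linearDr linearD /= Pkill Pfix add0r.
split=> // x y; split; first exact: avgl.
exact: left_averaging_right.
Qed.
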